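(* Let $\mathbf{Y}$ be a good, ergodic process of zero entropy rate. Assume additionally that there exists $L\ge1$ such that for almost every realization $\mathbf{y}$ of $\mathbf{Y}$, the corresponding set of return times $\{j\in\mathbb{Z}: y_j=1\}$ contains a two-sided infinite arithmetic progression $a+L\mathbb{Z}$ of difference $L$ (for some $a\in\mathbb{Z}$ depending on $\mathbf{y}$). Then there exists a stationary binary process $\mathbf{X}$, independent of $\mathbf{Y}$, that is not bilaterally deterministic and such that $\mathbf{H}(\mathbf{M})=\mathbf{H}(\mathbf{X})$, where $\mathbf{M}=\mathbf{X}\cdot\mathbf{Y}=(X_iY_i)_{i\in\mathbb{Z}}$.
   Context: All processes are bilateral (indexed by $\mathbb{Z}$); only their (joint) distributions matter, so the underlying probability space may be enlarged to carry $\mathbf{X}$. A process $\mathbf{Y}=(Y_i)_{i\in\mathbb{Z}}$ is called good if it is stationary, $\{0,1\}$-valued, $\mathbb{P}(Y_0=1)>0$, and almost surely $Y_i=1$ for infinitely many $i\ge 0$ and for infinitely many $i\le 0$. Binary means $\{0,1\}$-valued. For a stationary finitely-valued process $\mathbf{Z}$, $\mathbf{H}(\mathbf{Z})=\lim_n\frac1n\mathbf{H}(Z_0,\ldots,Z_{n-1})$ is its entropy rate ($\mathbf{H}$ of a finitely-valued random variable being Shannon entropy). A stationary finitely-valued process $\mathbf{Z}$ is bilaterally deterministic if for all $k\in\mathbb{N}$ $$\mathbf{H}\big(Z_{[0,k]}\mid Z_{(-\infty,-1]},Z_{[k+1,\infty)}\big)=0,$$ where $Z_A=(Z_i)_{i\in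 A}$, intervals are integer intervals, and conditional entropy is taken given the generated $\sigma$-algebra. *)

(* Defs.v *)
From HB Require Import structures.
From mathcomp Require Import all_boot all_order all_algebra.
From mathcomp Require Import all_classical all_reals all_analysis.

Set Implicit Arguments.
Unset Strict Implicit.
Unset Printing Implicit Defensive.

Import Order.TTheory GRing.Theory Num.Theory.
Import numFieldNormedType.Exports.

Local Open Scope classical_set_scope.
Local Open Scope ring_scope.

(* Bilateral processes with values in a finite alphabet A are families
   Z : int -> T -> A on a probability space (T, P); measurability of the
   coordinates is stated separately. *)

(* The product sigma-algebra on the space of bilateral sequences. *)
Definition seq_sigma (A : finType) : set (set (int -> A)) :=
  <<s [set C | exists (i : int) (a : A), C = [set z | z i = a]] >>.

Definition seq_shift (A : Type) (z : int -> A) : int -> A := fun i => z (i + 1).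

Definition realization (T A : Type) (Z : int -> T -> A) (w : T) : int -> A :=
  fun i => Z i w.

(* The sigma-algebra on the probability space generated by (Z_i)_{i in B}. *)
Definition sigma_process (T : Type) (A : finType) (Z : int -> T -> A)
    (B : set int) : set (set T) :=
  <<s [set C | exists (i : int) (a : A), B i /\ C = Z i @^-1` [set a]] >>.

Section Processes.
Context (R : realType) (d : measure_display) (T : measurableType d)
  (P : probability T R).

Definition stationary (A : finType) (Z : int -> T -> A) : Prop :=
  forall E, seq_sigma E ->
    P (realization Z @^-1` (@seq_shift A @^-1` E)) = P (realization Z @^-1` E).

Definition ergodic (A : finType) (Z : int -> T -> A) : Prop :=
  stationary Z /\
  forall E, seq_sigma E -> @seq_shift A @^-1` E = E ->
    P (realization Z @^-1` E) = 0%E \/ P (realization Z @^-1` E) = 1%E.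

Definition independent_processes (A B : finType)
    (X : int -> T -> A) (Y : int -> T -> B) : Prop :=
  forall E F, seq_sigma E -> seq_sigma F ->
    P (realization X @^-1` E `&` realization Y @^-1` F) =
    (P (realization X @^-1` E) * P (realization Y @^-1` F))%E.

Definition good (Y : int -> T -> bool) : Prop :=
  [/\ forall i, measurable_fun [set: T] (Y i),
      stationary Y,
      (0 < P (Y 0%R @^-1` [set true]))%E &
      {ae P, forall w, infinite_set [set i : int | 0 <= i /\ Y i w] /\
                       infinite_set [set i : int | i <= 0 /\ Y i w]}].

(* Entropies are in nats; the base of the logarithm only rescales them. *)
Definition eta (p : R) : R := - (p * ln p).

Definition entropy (A : finType) (V : T -> A) : R :=
  \sum_(a : A) eta (fine (P (V @^-1` [set a]))).

(* (Z_m, ..., Z_{m+n-1}) *)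
Definition block (A : finType) (Z : int -> T -> A) (m : int) (n : nat) (w : T)
  : {ffun 'I_n -> A} := [ffun j : 'I_n => Z (m + (j : nat)%:Z) w].

Definition entropy_rate (A : finType) (Z : int -> T -> A) : R :=
  limn (fun n : nat => n%:R^-1 * entropy (block Z 0 n)).

(* g is a version of the conditional probability of E given G. *)
Definition is_cond_prob (G : set (set T)) (E : set T) (g : T -> R) : Prop :=
  [/\ forall B : set R, measurable B -> G (g @^-1` B),
      P.-integrable [set: T] (EFin \o g) &
      forall C, G C -> (\int[P]_(w in C) (g w)%:E)%E = P (E `&` C)].

(* A chosen version: one exists, by Radon-Nikodym, whenever E is measurable and
   G is a sub-sigma-algebra, and any two of them agree P-almost everywhere; the
   default value is used only outside this situation. *)
Definition cond_prob (G : set (set T)) (E : set T) : T -> R :=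
  xget (cst 0) [set g | is_cond_prob G E g].

Definition cond_entropy (G : set (set T)) (A : finType) (V : T -> A) : \bar R :=
  (\int[P]_w (\sum_(a : A) eta (cond_prob G (V @^-1` [set a]) w))%R%:E)%E.

Definition bilaterally_deterministic (A : finType) (Z : int -> T -> A) : Prop :=
  forall k : nat,
    cond_entropy (sigma_process Z [set i : int | i <= -1 \/ k%:Z + 1 <= i])
      (block Z 0 k.+1) = 0%E.

End Processes.

(* Main.v *)
From HB Require Import structures.
Require Import Defs.
From mathcomp Require Import all_boot all_order all_algebra.
From mathcomp Require Import all_classical all_reals all_analysis.
From mathcomp Require Import measurable_realfun.
From mathcomp Require Import ring lra zify.

(** Write L for the difference of the progression contained in the return times;
    being positive, it is denoted by L.+1 in the definitions and lemmas.  Cut the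
    integers into consecutive blocks of length L, the position of the cuts being
    uniform modulo L (the phase), and let X be constant on each block, with value
    an independent fair coin.  The random phase makes X stationary
    ([block_process_stationary]), and X is taken on a product space, hence
    independent of Y.

    X is not bilaterally deterministic: the window [0, 2L] contains the whole of
    block number 1 whatever the phase is, so the coin of that block is invisible
    from outside the window.  Flipping it preserves the law of X and every event
    observed outside, while it changes X inside the window
    ([block_process_not_deterministic]).  To use this, vanishing of the
    conditional entropy is first turned into the statement that each event of
    the window is, up to a null set, an event observed outside
    ([cond_entropy_eq0]).

    The product M = XY has the entropy rate of X.  On the one hand M is a function
    of X and Y, and Y has zero entropy rate ([entropy_masked_le]).  On the other
    hand a progression of difference L meets every block exactly once, so M, the
    phase and the residue of the progression determine X, except perhaps on the
    two blocks that straddle the ends of the window; hence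
    H(X_0, ..., X_(n-1)) <= H(M_0, ..., M_(n-1)) + C with C independent of n
    ([entropy_masked_ge]).  Dividing by n gives the claim; the limits exist by
    subadditivity of block entropies ([entropy_rate_cvg]), and this is also what
    makes the hypothesis on the entropy rate of Y a genuine limit rather than
    the default value of an undefined one. *)

Import Order.TTheory GRing.Theory Num.Theory.
Import numFieldNormedType.Exports.

Local Open Scope classical_set_scope.
Local Open Scope ring_scope.

Set Implicit Arguments.
Unset Strict Implicit.
Unset Printing Implicit Defensive.

(** * Entropy of finitely-valued random variables *)

Lemma eta_ge0 (R : realType) (p : R) : p <= 1 -> 0 <= eta p.
Proof.
move=> p1; rewrite /eta oppr_ge0; have [p0|p0] := ltP 0 p.
  by rewrite pmulr_rle0// ln_le0.
by rewrite ln0// mulr0.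
Qed.

(** Pointwise form of the nonnegativity of relative entropy: the concavity
    inequality ln t <= t - 1 taken at t = q / p. *)
Lemma gibbs (R : realType) (p q : R) : 0 <= p -> 0 <= q ->
  (q = 0 -> p = 0) -> p * ln q + eta p <= q - p.
Proof.
rewrite le_eqVlt => /orP[/eqP<- q0 _|p0].
  by rewrite /eta !mul0r !oppr0 !addr0.
rewrite le_eqVlt => /orP[/eqP q0 /(_ (esym q0)) p00|q0 _].
  by rewrite p00 ltxx in p0.
have -> : p * ln q + eta p = p * ln (q / p).
  by rewrite ln_div ?posrE// /eta mulrBr.
have -> : q - p = p * (q / p - 1) by field; rewrite gt_eqF.
rewrite ler_pM2l//.
have := @le_ln1Dx R (q / p - 1).
rewrite addrCA subrr addr0; apply.
by rewrite ltrBDr addrC subrr divr_gt0.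
Qed.

Lemma eta_le1 (R : realType) (p : R) : 0 <= p -> eta p <= 1.
Proof.
move=> p0; have := @gibbs R p 1 p0 ler01.
rewrite ln1 mulr0 add0r => h; apply: (le_trans (h _)).
  by move/eqP; rewrite oner_eq0.
by rewrite lerBlDr lerDl.
Qed.

(** Measurability for the discrete sigma-algebra on the alphabet. *)
Definition finite_rv (d : measure_display) (T : measurableType d) (A : finType)
  (V : T -> A) := forall a, measurable (V @^-1` [set a]).

Lemma finite_rv_measurable_comp (d d' : measure_display) (T : measurableType d)
    (T' : measurableType d') (A : finType) (q : T' -> T) (V : T -> A) :
  measurable_fun setT q -> finite_rv V -> finite_rv (V \o q).
Proof. by move=> mq mV a; have := mq measurableT _ (mV a); rewrite setTI. Qed.

Section FiniteEntropy.
Context {R : realType} {d : measure_display} {T : measurableType d}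
  (P : probability T R).

Definition mass (A : finType) (V : T -> A) a : R := fine (P (V @^-1` [set a])).

Lemma finite_rv_preimage (A : finType) (V : T -> A) (S : set A) :
  finite_rv V -> measurable (V @^-1` S).
Proof.
move=> mV; rewrite (_ : _ @^-1` _ = \bigcup_(a in S) V @^-1` [set a]).
  by apply: fin_bigcup_measurable => //; exact: finite_finset.
by apply/seteqP; split=> [w Sw|w [a Sa /= ->]//]; exists (V w).
Qed.

Lemma finite_rv_comp (A B : finType) (V : T -> A) (f : A -> B) :
  finite_rv V -> finite_rv (f \o V).
Proof. by move=> mV b; rewrite comp_preimage; exact: finite_rv_preimage. Qed.

Lemma finite_rv_pair (A B : finType) (V : T -> A) (W : T -> B) :
  finite_rv V -> finite_rv W -> finite_rv (fun w => (V w, W w)).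
Proof.
move=> mV mW [a b]; rewrite (_ : _ @^-1` _ = V @^-1` [set a] `&` W @^-1` [set b]).
  exact: measurableI.
by apply/seteqP; split=> w /= [-> ->].
Qed.

Lemma mass_ge0 (A : finType) (V : T -> A) a : 0 <= mass V a.
Proof. by rewrite fine_ge0. Qed.

Lemma mass_le1 (A : finType) (V : T -> A) a : finite_rv V -> mass V a <= 1.
Proof.
move=> mV; rewrite /mass -lee_fin fineK ?fin_num_measure//.
exact: probability_le1.
Qed.

Lemma mass_preimage (A : finType) (V : T -> A) (S : {pred A}) : finite_rv V ->
  fine (P (V @^-1` [set a | a \in S])) = \sum_(a in S) mass V a.
Proof.
move=> mV; rewrite (_ : _ @^-1` _ = \bigcup_(a in [set` S]) V @^-1` [set a]).
  have tV : trivIset [set` S] (fun a => V @^-1` [set a]).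
    by move=> a b _ _ [w [/= <- <-]].
  rewrite measure_fin_bigcup//.
  rewrite fsbig_finite; last exact: finite_finset.
  rewrite -sum_fine; last by move=> a _; rewrite fin_num_measure.
  rewrite -[RHS]big_enum/=.
  apply: perm_big; apply: uniq_perm; rewrite ?enum_uniq ?finmap.fset_uniq//.
  move=> a; rewrite mem_enum in_fset_set ?inE//.
  by rewrite mem_setE.
by apply/seteqP; split=> [w Sw|w [a Sa /= ->]//]; exists (V w).
Qed.

Lemma sum_mass (A : finType) (V : T -> A) : finite_rv V -> \sum_a mass V a = 1.
Proof.
move=> mV; rewrite -(mass_preimage predT mV) (_ : _ @^-1` _ = setT).
  by rewrite probability_setT.
by apply/seteqP; split.
Qed.

Lemma mass_comp (A B : finType) (V : T -> A) (f : A -> B) b : finite_rv V ->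
  mass (f \o V) b = \sum_(a | f a == b) mass V a.
Proof.
move=> mV; rewrite -(mass_preimage [pred a | f a == b] mV) /mass; congr (fine (P _)).
by apply/seteqP; split=> w /=; rewrite inE => /eqP.
Qed.

Lemma mass_pairl (A B : finType) (V : T -> A) (W : T -> B) a :
  finite_rv V -> finite_rv W ->
  mass V a = \sum_b mass (fun w => (V w, W w)) (a, b).
Proof.
move=> mV mW; have mVW := finite_rv_pair mV mW.
rewrite [LHS](mass_comp fst a mVW).
transitivity (\sum_(i | i == a) \sum_b mass (fun w => (V w, W w)) (i, b)).
  by rewrite pair_big/=; apply: eq_big => -[i b]/=; rewrite ?andbT.
by rewrite big_pred1_eq.
Qed.

Lemma mass_pairr (A B : finType) (V : T -> A) (W : T -> B) b :
  finite_rv V -> finite_rv W ->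
  mass W b = \sum_a mass (fun w => (V w, W w)) (a, b).
Proof.
move=> mV mW; rewrite (mass_pairl b mW mV); apply: eq_bigr => a _.
by congr (fine (P _)); apply/seteqP; split=> w /= [-> ->].
Qed.

Lemma entropyE (A : finType) (V : T -> A) :
  entropy P V = \sum_a eta (mass V a).
Proof. by []. Qed.

Lemma entropy_ge0 (A : finType) (V : T -> A) : finite_rv V -> 0 <= entropy P V.
Proof. by move=> mV; apply: sumr_ge0 => a _; rewrite eta_ge0// mass_le1. Qed.

Lemma entropy_le_card (A : finType) (V : T -> A) : entropy P V <= #|A|%:R.
Proof.
rewrite entropyE -sum1_card natr_sum; apply: ler_sum => a _.
by rewrite eta_le1// mass_ge0.
Qed.

(** The masses of f o V are sums of masses of V, and ln is nondecreasing. *)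
Lemma entropy_comp_le (A B : finType) (V : T -> A) (f : A -> B) : finite_rv V ->
  entropy P (f \o V) <= entropy P V.
Proof.
move=> mV; rewrite !entropyE (partition_big f predT)//=.
apply: ler_sum => b _; rewrite /eta mass_comp// mulr_suml -sumrN.
apply: ler_sum => a fab; rewrite lerN2.
have := mass_ge0 V a; rewrite le_eqVlt => /orP[/eqP<-|pa0]; first by rewrite !mul0r.
rewrite ler_pM2l// ler_ln ?posrE//.
  by rewrite (bigD1 a)//= lerDl sumr_ge0// => i _; exact: mass_ge0.
by rewrite (bigD1 a)//= ltr_wpDr// sumr_ge0// => i _; exact: mass_ge0.
Qed.

(** Summing [gibbs] with p the joint mass and q the product of the marginal
    masses: both sum to 1, so the right-hand sides cancel. *)
Lemma entropy_pair_le (A B : finType) (V : T -> A) (W : T -> B) :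
  finite_rv V -> finite_rv W ->
  entropy P (fun w => (V w, W w)) <= entropy P V + entropy P W.
Proof.
move=> mV mW; have mVW := finite_rv_pair mV mW.
pose m := mass (fun w => (V w, W w)).
have HV : entropy P V = - \sum_a \sum_b m (a, b) * ln (mass V a).
  rewrite entropyE /eta sumrN; congr (- _); apply: eq_bigr => a _.
  by rewrite -mulr_suml -mass_pairl.
have HW : entropy P W = - \sum_a \sum_b m (a, b) * ln (mass W b).
  rewrite entropyE /eta sumrN; congr (- _); rewrite exchange_big/=.
  by apply: eq_bigr => b _; rewrite -mulr_suml -mass_pairr.
have HVW : entropy P (fun w => (V w, W w)) = \sum_a \sum_b eta (m (a, b)).
  by rewrite entropyE pair_big/=; apply: eq_bigr => -[].
have le1 a b : m (a, b) <= mass V a.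
  rewrite (mass_pairl a mV mW) (bigD1 b)//= lerDl.
  by apply: sumr_ge0 => *; exact: mass_ge0.
have le2 a b : m (a, b) <= mass W b.
  rewrite (mass_pairr b mV mW) (bigD1 a)//= lerDl.
  by apply: sumr_ge0 => *; exact: mass_ge0.
have key a b : m (a, b) * ln (mass V a) + m (a, b) * ln (mass W b) + eta (m (a, b))
    <= mass V a * mass W b - m (a, b).
  have := mass_ge0 (fun w => (V w, W w)) (a, b).
  rewrite -/m le_eqVlt => /orP[/eqP m0|m0].
    by rewrite -m0 /eta !mul0r !oppr0 !addr0 mulr_ge0// mass_ge0.
  have Va0 := lt_le_trans m0 (le1 a b); have Wb0 := lt_le_trans m0 (le2 a b).
  rewrite -mulrDr -lnM ?posrE//; apply: gibbs; rewrite ?ltW ?mulr_gt0//.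
  by move/eqP; rewrite gt_eqF// mulr_gt0.
have : \sum_a \sum_b (m (a, b) * ln (mass V a) + m (a, b) * ln (mass W b) + eta (m (a, b)))
    <= \sum_a \sum_b (mass V a * mass W b - m (a, b)).
  by apply: ler_sum => a _; apply: ler_sum => b _; exact: key.
have -> : \sum_a \sum_b (mass V a * mass W b - m (a, b)) = 0.
  under eq_bigr do rewrite sumrB -mulr_sumr (sum_mass mW) mulr1.
  rewrite sumrB (sum_mass mV); under eq_bigr do rewrite -mass_pairl//.
  by rewrite (sum_mass mV) subrr.
under eq_bigr do rewrite !big_split/=.
rewrite !big_split/= -HVW -[X in X + _ + _]opprK -HV -[X in _ + X + _]opprK -HW.
lra.
Qed.

Lemma ae_eq_probability (A B : set T) : measurable A -> measurable B ->
  {ae P, forall w, A w <-> B w} -> P A = P B.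
Proof.
suff H C D : measurable C -> measurable D ->
    {ae P, forall w, C w <-> D w} -> (P C <= P D)%E.
  move=> mA mB AB; apply/eqP; rewrite eq_le !H//.
  by apply: filterS AB => w [].
move=> mC mD [N [mN N0 CDN]]; rewrite -[P D]adde0 -N0.
apply: (le_trans _ (measureU2 _ _ _)) => //; apply: le_measure; rewrite ?inE//.
  exact: measurableU.
move=> w Cw; have [Dw|nDw] := pselect (D w); [by left|right].
by apply: CDN => /= -[/(_ Cw)].
Qed.

Lemma eq_entropy (A : finType) (V W : T -> A) : finite_rv V -> finite_rv W ->
  {ae P, forall w, V w = W w} -> entropy P V = entropy P W.
Proof.
move=> mV mW VW; apply: eq_bigr => a _; congr (eta (fine _)).
by apply: ae_eq_probability => //; apply: filterS VW => w /= ->.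
Qed.
End FiniteEntropy.

(** * Entropy rates of stationary binary processes *)

Lemma subadditive_mul (R : realType) (u : R^nat) :
  (forall m n, u (m + n)%N <= u m + u n) -> u 0%N = 0 ->
  forall m q, u (q * m)%N <= q%:R * u m.
Proof.
move=> su u0 m; elim=> [|q IH]; first by rewrite mul0n u0 mul0r.
rewrite mulSn -natr1 mulrDl mul1r addrC; apply: le_trans (su _ _) _.
by rewrite lerD2l.
Qed.

(** Fekete's lemma.  The limit is the infimum of u n / n over n > 0: if m nearly
    attains it, then u n <= (n %/ m) u m + (n %% m) u 1, and the last term is
    bounded by m u 1. *)
Lemma subadditive_cvg (R : realType) (u : R^nat) :
  (forall n, 0 <= u n) -> u 0%N = 0 ->
  (forall m n, u (m + n)%N <= u m + u n) ->
  cvgn (fun n => n%:R^-1 * u n).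
Proof.
move=> u_ge0 u0 su.
pose v n := n%:R^-1 * u n.
pose S := [set v n | n in [set n | (0 < n)%N]].
have v_ge0 n : 0 <= v n by rewrite mulr_ge0.
have S0 : has_inf S.
  split; first by exists (v 1%N), 1%N.
  by exists 0 => _ [n _ <-].
have inf_le n : (0 < n)%N -> inf S <= v n.
  by move=> n0; apply: (ge_inf (proj2 S0)); exists n.
apply: (cvgP (inf S)); apply/cvgrPdist_lt => e e0.
have e20 : 0 < e / 2 by rewrite divr_gt0.
have [_ [m m0 <-] vm] := inf_adherent e20 S0.
have mR : 0 < m%:R :> R by rewrite ltr0n.
pose c := m%:R * u 1%N.
near=> n.
have n0 : (0 < n)%N by near: n; exists 1%N.
have nR : 0 < n%:R :> R by rewrite ltr0n.
have cn : n%:R^-1 * c < e / 2.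
  rewrite mulrC ltr_pdivrMr// mulrC -ltr_pdivrMr//.
  by near: n; exact: nbhs_infty_gtr.
rewrite distrC ger0_norm ?subr_ge0 ?inf_le// ltrBlDl.
suff : v n <= v m + n%:R^-1 * c by rewrite -/(v n); lra.
have un : u n <= (n %/ m)%:R * u m + (n %% m)%:R * u 1%N.
  rewrite {1}(divn_eq n m); apply: le_trans (su _ _) _.
  rewrite lerD ?subadditive_mul//.
  by rewrite -[X in u X <= _]muln1; exact: subadditive_mul.
rewrite /v mulrC ler_pdivrMr// mulrDl [_ * c * _]mulrAC mulVf ?gt_eqF// mul1r.
apply: le_trans un _; apply: lerD.
  rewrite mulrAC ler_wpM2r// ler_pdivlMl//.
  by rewrite -natrM ler_nat mulnC leq_divM.
by rewrite ler_wpM2r// ler_nat ltnW// ltn_pmod.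
Unshelve. all: by end_near. Qed.

(** The space of bilateral binary sequences as a measurable type; its measurable
    sets are those of [seq_sigma], by conversion. *)
Definition binseq : Type :=
  g_sigma_algebraType [set C | exists (i : int) (a : bool), C = [set z : int -> bool | z i = a]].

HB.instance Definition _ := Measurable.on binseq.

Lemma seq_sigmaE : @seq_sigma bool = (measurable : set (set binseq)).
Proof. by []. Qed.

Lemma measurable_coord (i : int) (a : bool) : measurable [set z : binseq | z i = a].
Proof. by apply: sub_sigma_algebra; exists i, a. Qed.

Lemma finite_rv_block (d : measure_display) (T : measurableType d) (A : finType)
    (Z : int -> T -> A) m n :
  (forall i, finite_rv (Z i)) -> finite_rv (block Z m n).
Proof.
move=> mZ a.
rewrite (_ : _ @^-1` _ =
    \bigcap_(j in [set: 'I_n]) Z (m + (j : nat)%:Z) @^-1` [set a j]).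
  by apply: fin_bigcap_measurable => // j _; exact: mZ.
apply/seteqP; split=> w /=.
  by move=> <- j _ /=; rewrite ffunE.
by move=> h; apply/ffunP => j; rewrite ffunE; exact: h.
Qed.

Section StationaryEntropy.
Context {R : realType} {d : measure_display} {T : measurableType d}
  (P : probability T R).
Variable Z : int -> T -> bool.
Hypotheses (mZ : forall i, finite_rv (Z i)) (sZ : stationary P Z).

Lemma mass_block_shift n (m : nat) : mass P (block Z m%:Z n) = mass P (block Z 0 n).
Proof.
elim: m => [//|m <-]; apply/funext => a; congr (fine _).
pose E : set binseq :=
  \bigcap_(j in [set: 'I_n]) [set z : binseq | z (m%:Z + (j : nat)%:Z) = a j].
have mE : seq_sigma E.
  by rewrite seq_sigmaE; apply: fin_bigcap_measurable => // j _; exact: measurable_coord.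
have H k (F : set (int -> bool)) : (forall w, F (realization Z w) <->
    forall j : 'I_n, Z (k + (j : nat)%:Z) w = a j) ->
    block Z k n @^-1` [set a] = realization Z @^-1` F.
  move=> h; apply/seteqP; split=> w /=.
    by move=> Zwa; apply/h => j; rewrite -Zwa ffunE.
  by move=> /h {}h; apply/ffunP => j; rewrite ffunE.
rewrite (H m%:Z E); last first.
  by move=> w; split=> [h j|h j _]; [exact: (h j I)|exact: h].
rewrite (H _ (@seq_shift bool @^-1` E)); first exact: sZ.
have e (j : 'I_n) : m.+1%:Z + (j : nat)%:Z = m%:Z + (j : nat)%:Z + 1 by lia.
move=> w; split=> [h j|h j _]; first by rewrite e; exact: (h j I).
by rewrite /seq_shift /realization/= -e; exact: h.
Qed.

Lemma entropy_block_shift n (m : nat) :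
  entropy P (block Z m%:Z n) = entropy P (block Z 0 n).
Proof. by rewrite !entropyE mass_block_shift. Qed.

Lemma entropy_blockD m n : entropy P (block Z 0 (m + n)) <=
  entropy P (block Z 0 m) + entropy P (block Z 0 n).
Proof.
rewrite -(entropy_block_shift n m).
apply: (le_trans _ (entropy_pair_le _ _ _)); [|exact: finite_rv_block..].
pose f (p : {ffun 'I_m -> bool} * {ffun 'I_n -> bool}) : {ffun 'I_(m + n) -> bool} :=
  [ffun j => match fintype.split j with inl i => p.1 i | inr i => p.2 i end].
rewrite (_ : block Z 0 (m + n) = f \o fun w => (block Z 0 m w, block Z m%:Z n w)).
  by apply: entropy_comp_le; apply: finite_rv_pair; exact: finite_rv_block.
apply/funext => w; apply/ffunP => j; rewrite !ffunE/=.
by case: fintype.splitP => i ji; rewrite ffunE ji// add0r PoszD.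
Qed.

Lemma entropy_rate_cvg : cvgn (fun n : nat => n%:R^-1 * entropy P (block Z 0 n)).
Proof.
apply: subadditive_cvg => [n||m n]; last exact: entropy_blockD.
  by apply: entropy_ge0; exact: finite_rv_block.
rewrite entropyE big1// => a _; rewrite /mass (_ : _ @^-1` _ = setT).
  by rewrite probability_setT /eta/= ln1 mulr0 oppr0.
by apply/seteqP; split=> // w _; apply/ffunP => -[].
Qed.
End StationaryEntropy.

(** * A probability space with a uniform phase and fair coins *)

Section UnitInterval.
Context (R : realType).

(** The uniform law on the unit interval. *)
Definition unit_measure : set (measurableTypeR R) -> \bar R :=
  mrestr (@lebesgue_measure R) (measurable_itv `[0%R, 1%R[).

Let mu : {measure set (measurableTypeR R) -> \bar R} :=
  mrestr (@lebesgue_measure R) (measurable_itv `[0%R, 1%R[).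

HB.instance Definition _ := isMeasure.Build _ _ _ unit_measure
  (measure0 mu) (measure_ge0 mu) (@measure_semi_sigma_additive _ _ _ mu).

Lemma unit_measure_setT : unit_measure setT = 1%E.
Proof.
by rewrite /unit_measure /mrestr setTI lebesgue_measure_itv/= lte_fin ltr01 oppr0 adde0.
Qed.

HB.instance Definition _ := Measure_isProbability.Build _ _ _ unit_measure unit_measure_setT.

(** For x in [0, 1[ this is the index of the interval of length 1 / N that
    contains x; for N = 2 ^ n its binary digits are the first n digits of x. *)
Definition ndigit (N : nat) (x : measurableTypeR R) : nat := Num.truncn (N%:R * x).

Lemma ndigit_preimage (N m : nat) : (0 < N)%N ->
  ndigit N @^-1` [set m] `&` `[0, 1[ =
  `[m%:R / N%:R, m.+1%:R / N%:R[ `&` `[0, 1[.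
Proof.
move=> N0; have NR : 0 < N%:R :> R by rewrite ltr0n.
apply/seteqP; split => x /=; rewrite !in_itv/= => -[mx /andP[x0 x1]]; rewrite x0 x1; split=> //.
  rewrite -mx ler_pdivrMr// ltr_pdivlMr// ![x * _]mulrC; apply: truncn_itv.
  by rewrite mulr_ge0// ler0n.
move: mx; rewrite ler_pdivrMr// ltr_pdivlMr// ![x * _]mulrC => mx.
by apply: truncn_def.
Qed.

Lemma measurable_ndigit (N m : nat) : (0 < N)%N -> measurable (ndigit N @^-1` [set m]).
Proof.
move=> N0; have NR : 0 < N%:R :> R by rewrite ltr0n.
case: m => [|m].
  rewrite (_ : _ @^-1` _ = `]-oo, N%:R^-1[%classic); first exact: measurable_itv.
  apply/seteqP; split => x /=; rewrite in_itv/= -[x < _](ltr_pM2l NR) divff ?gt_eqF//.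
    by move=> t0; rewrite ltNge -(@truncn_gt_nat R _ 0) -/(ndigit N x) t0.
  by rewrite ltNge -(@truncn_gt_nat R _ 0) -leqNgt leqn0 => /eqP.
rewrite (_ : _ @^-1` _ = `[m.+1%:R / N%:R, m.+2%:R / N%:R[%classic); first exact: measurable_itv.
apply/seteqP; split => x /=; rewrite in_itv/= ler_pdivrMr// ltr_pdivlMr// ![x * _]mulrC.
  move=> mx; rewrite -mx; apply: truncn_itv; rewrite leNgt; apply/negP => x0.
  have : (0 < ndigit N x)%N by rewrite mx.
  by rewrite /ndigit truncn_gt_nat leNgt (lt_trans x0).
by move=> h; apply: truncn_def.
Qed.

Lemma finite_rv_ndigit (A : finType) (N : nat) (f : nat -> A) : (0 < N)%N ->
  finite_rv (f \o ndigit N).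
Proof.
move=> N0 a; rewrite (_ : _ @^-1` _ = \bigcup_(m in [set m | f m = a]) ndigit N @^-1` [set m]).
  by apply: bigcup_measurable => m _; exact: measurable_ndigit.
apply/seteqP; split => [x fx|x [m /= <- <-]//].
by exists (ndigit N x).
Qed.

Lemma unit_measure_ndigit (N m : nat) : (0 < N)%N ->
  (unit_measure (ndigit N @^-1` [set m]) <= N%:R^-1%:E)%E.
Proof.
move=> N0; have NR : 0 < N%:R :> R by rewrite ltr0n.
rewrite /unit_measure /mrestr ndigit_preimage//.
apply: (@le_trans _ _ (lebesgue_measure `[(m%:R / N%:R : R), m.+1%:R / N%:R[)).
  by apply: le_measure; rewrite ?inE//; exact: measurableI.
rewrite lebesgue_measure_itv/= lte_fin ltr_pM2r ?invr_gt0// ltr_nat ltnSn.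
by rewrite -EFinB lee_fin -mulrBl -natrB// subSn// subnn mul1r.
Qed.

Definition digit (k : nat) (x : measurableTypeR R) : bool := odd (ndigit (2 ^ k.+1) x).

Lemma ndigit_half k x : (ndigit (2 ^ k.+1) x)./2 = ndigit (2 ^ k) x.
Proof.
rewrite /ndigit expnS natrM -mulrA; move: (_ * x) => {x} y.
have [y0|y0] := leP 0 y; last first.
  have y20 : (2 * y < 0)%R by rewrite pmulr_rlt0.
  by rewrite !truncn_floor !leNgt y0 y20.
have y20 : 0 <= 2%:R * y by rewrite mulr_ge0.
have /andP[t1 t2] := truncn_itv y20.
apply/esym/truncn_def; move: t1 t2; set t := Num.truncn _ => t1 t2.
have tE : t%:R = (odd t)%:R + 2 * (t./2)%:R :> R.
  by rewrite -{1}(odd_double_half t) natrD -mul2n natrM.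
rewrite -[t.+1%:R]natr1 -[_./2.+1%:R]natr1 in t2 *.
by case: (odd t) tE => /= tE; lra.
Qed.

(** The integer with binary digits b 0, ..., b (n - 1), b 0 the most significant. *)
Fixpoint encode (n : nat) (b : nat -> bool) : nat :=
  if n is n'.+1 then (b n' + (encode n' b).*2)%N else 0%N.

Lemma ndigit_encode n (x : R) : 0 <= x < 1 -> ndigit (2 ^ n) x = encode n (digit ^~ x).
Proof.
move=> x01; elim: n => [|n IH]/=.
  by rewrite /ndigit expn0 mul1r; apply: truncn_def.
by rewrite -IH -[LHS]odd_double_half ndigit_half.
Qed.

Definition digits n (x : measurableTypeR R) : {ffun 'I_n -> bool} := [ffun i : 'I_n => digit i x].

Lemma finite_rv_digit k : finite_rv (digit k).
Proof. by apply: finite_rv_ndigit; rewrite expn_gt0. Qed.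

Lemma finite_rv_digits n : finite_rv (digits n).
Proof.
move=> f; rewrite (_ : _ @^-1` _ = \bigcap_(i in [set: 'I_n]) digit i @^-1` [set f i]).
  by apply: fin_bigcap_measurable => // i _; exact: finite_rv_digit.
apply/seteqP; split => x /=.
  by move=> <- j _ /=; rewrite ffunE.
by move=> h; apply/ffunP => j; rewrite ffunE; exact: h.
Qed.

(** The masses sum to 1, so that none of the upper bounds can be strict.  This
    reduces the laws of the digits and of the phase to upper bounds for the
    lengths of intervals. *)
Lemma eq_mass_uniform (d : measure_display) (T : measurableType d) (P : probability T R)
  (A : finType) (V : T -> A) : finite_rv V ->
  (forall a, mass P V a <= #|A|%:R^-1) -> forall a, mass P V a = #|A|%:R^-1.
Proof.
move=> mV le a.
have : \sum_a (#|A|%:R^-1 - mass P V a) = 0.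
  rewrite sumrB sum_mass// sumr_const -[_ *+ _]mulr_natr mulVf ?subrr//.
  by rewrite pnatr_eq0 -lt0n; apply/card_gt0P; exists a.
move/eqP; rewrite psumr_eq0; last by move=> i _; rewrite subr_ge0.
by move=> /allP /(_ a); rewrite mem_index_enum => /(_ isT) /=; rewrite subr_eq0 => /eqP.
Qed.

Lemma mass_digits n (f : {ffun 'I_n -> bool}) :
  mass unit_measure (digits n) f = (2 ^ n)%:R^-1.
Proof.
have cE : #|{ffun 'I_n -> bool}| = (2 ^ n)%N by rewrite card_ffun card_bool card_ord.
rewrite -cE; apply: eq_mass_uniform; first exact: finite_rv_digits.
move=> {}f; rewrite /mass -lee_fin fineK ?fin_num_measure//; last exact: finite_rv_digits.
have n0 : (0 < 2 ^ n)%N by rewrite expn_gt0.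
pose b k := if insub k is Some i then f i else false.
rewrite cE; apply: le_trans (unit_measure_ndigit (encode n b) n0).
rewrite /unit_measure /mrestr; apply: (@le_measure _ _ _ (@lebesgue_measure R)); rewrite ?inE.
- by apply: measurableI => //; exact: finite_rv_digits.
- by apply: measurableI => //; exact: measurable_ndigit.
move=> x [/= fx]; rewrite in_itv/= => x01; rewrite x01; split=> //.
rewrite ndigit_encode//.
have : forall k, (k <= n)%N -> encode k (digit ^~ x) = encode k b.
  elim=> [_|k IH kn]; first by [].
  have bk : digit k x = b k by rewrite /b insubT -fx ffunE SubK.
  by rewrite [LHS]/= bk IH// ltnW.
by apply.
Qed.

(** Complete the digits in J to the first n digits, which are uniform; there are
    2 ^ (n - size J) completions. *)
Lemma unit_measure_digits (J : seq nat) (a : nat -> bool) : uniq J ->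
  unit_measure [set x | forall k, k \in J -> digit k x = a k] =
  ((2 ^ size J)%:R^-1)%:E.
Proof.
move=> uJ; pose n := (\max_(k <- J) k).+1.
have Jn k : k \in J -> (k < n)%N by move=> kJ; rewrite ltnS; apply: leq_bigmax_seq.
pose F (i : 'I_n) : pred bool := if (i : nat) \in J then pred1 (a i) else predT.
have -> : [set x | forall k, k \in J -> digit k x = a k] =
    digits n @^-1` [set f | f \in family F].
  apply/seteqP; split => x /=.
    move=> h; apply/familyP => i; rewrite /F; case: ifP => // iJ.
    by rewrite ffunE inE h.
  move=> /familyP h k kJ; have := h (Ordinal (Jn k kJ)).
  by rewrite /F ffunE/= kJ inE => /eqP.
have mD : measurable (digits n @^-1` [set f | f \in family F]).
  by apply: finite_rv_preimage; exact: finite_rv_digits.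
rewrite -[LHS]fineK ?fin_num_measure//; congr EFin.
rewrite mass_preimage; last exact: finite_rv_digits.
under eq_bigr do rewrite mass_digits.
have sJ : size (pmap (insub : nat -> option 'I_n) J) = size J.
  rewrite size_pmap_sub; apply/eqP; rewrite -all_count; apply/allP => k; exact: Jn.
have sJn : (size J <= n)%N.
  rewrite -sJ -[X in (_ <= X)%N](card_ord n) -(card_uniqP _) ?max_card//.
  exact: pmap_sub_uniq.
rewrite sumr_const card_family.
have -> : foldr muln 1%N [seq #|F x| | x : 'I_n] = (2 ^ (n - size J))%N.
  rewrite foldrE big_map big_enum/=.
  rewrite (eq_bigr (fun i : 'I_n => if (i : nat) \notin J then 2 else 1)%N); last first.
    by move=> i _; rewrite /F; case: (_ \in J); rewrite ?card1// cardT enumT -enumT -cardT card_bool.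
  rewrite -big_mkcond/= prod_nat_const; congr (_ ^ _)%N.
  have -> : size J = #|[pred i : 'I_n | (i : nat) \in J]|.
    rewrite -sJ -(card_uniqP (pmap_sub_uniq _ uJ)); apply: eq_card => i.
    by rewrite mem_pmap_sub.
  have := cardC [pred i : 'I_n | (i : nat) \in J].
  rewrite [X in _ = X]card_ord => /(congr1 (subn^~ #|[pred i : 'I_n | (i : nat) \in J]|)).
  by rewrite addKn => <-; exact: eq_card.
rewrite -[_ *+ _]mulr_natr -{1}(subnK sJn) expnD natrM invfM mulrAC mulVf ?mul1r//.
Qed.
End UnitInterval.

Section FairCoins.
Context {R : realType}.

(** ph is uniform on L.+1 values, the B i are fair coins, and all of them are
    independent. *)
Record fair_coins (d : measure_display) (T : measurableType d)
    (P : probability T R) (L : nat) (ph : T -> 'I_L.+1) (B : int -> T -> bool) : Prop := {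
  finite_rv_phase : finite_rv ph ;
  finite_rv_coins : forall i, finite_rv (B i) ;
  fair_cylinder : forall p (J : seq int) (a : int -> bool), uniq J ->
    P ([set w | ph w = p] `&` [set w | forall i, i \in J -> B i w = a i]) =
    (L.+1%:R^-1 * (2 ^ size J)%:R^-1)%:E }.

(** Take two independent uniform variables in the unit interval: the phase is
    the integer part of L.+1 times the first one, and the coins are the binary
    digits of the second one, indexed by the integers through [pickle]. *)
Lemma fair_coins_exist (L : nat) :
  exists (d : measure_display) (T : measurableType d) (P : probability T R)
    (ph : T -> 'I_L.+1) (B : int -> T -> bool), fair_coins P ph B.
Proof.
pose U := measurableTypeR R.
pose f (u : U) : 'I_L.+1 := inord (ndigit L.+1 u).
exists _, (U * U)%type, (@unit_measure R \x @unit_measure R)%E.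
exists (f \o fst), (fun i => digit (pickle i) \o snd).
have mf : finite_rv f by exact: (@finite_rv_ndigit R _ L.+1 inord).
have Ef p : unit_measure (f @^-1` [set p]) = L.+1%:R^-1%:E.
  rewrite -[LHS]fineK ?fin_num_measure//; congr EFin.
  rewrite -[X in _ = X%:R^-1](card_ord L.+1); apply: eq_mass_uniform => // {}p.
  rewrite card_ord /mass -lee_fin fineK ?fin_num_measure//.
  apply: le_trans (unit_measure_ndigit R p (ltn0Sn L)).
  rewrite /unit_measure /mrestr; apply: (@le_measure _ _ _ (@lebesgue_measure R)); rewrite ?inE.
  - by apply: measurableI => //; exact: mf.
  - by apply: measurableI => //; exact: measurable_ndigit.
  move=> x [/= fx]; rewrite in_itv/= => x01; rewrite x01; split=> //.
  rewrite -fx /f inordK// ltnS -ltnS /ndigit.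
  case/andP: x01 => x0 x1.
  by rewrite truncn_lt_nat ?mulr_ge0// gtr_pMr.
split => //.
- exact: finite_rv_measurable_comp measurable_fst mf.
- by move=> i; apply: finite_rv_measurable_comp measurable_snd _; exact: finite_rv_digit.
move=> p J a uJ.
rewrite (_ : _ `&` _ = (f @^-1` [set p]) `*`
  [set x | forall k, k \in map pickle J -> digit k x =
     (if unpickle k is Some i then a i else false)]); last first.
  apply/seteqP; split => -[u x] /= [fu h]; split=> //.
    by move=> _ /mapP[i iJ ->]; rewrite pickleK h.
  by move=> i iJ; rewrite h ?pickleK// map_f.
have uJ' : uniq (map pickle J) by rewrite map_inj_uniq//; exact: (pcan_inj pickleK).
set S := [set x | _].
have mS : measurable (S : set U).
  rewrite (_ : S = \bigcap_(k in [set` map pickle J]) digit k @^-1`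
      [set (if unpickle k is Some i then a i else false)]); last by apply/seteqP; split.
  by apply: fin_bigcap_measurable => // k _; exact: finite_rv_digit.
etransitivity; first exact: (product_measure1E _ _ (mf p) mS).
rewrite EFinM; congr (_ * _)%E; first exact: Ef.
by rewrite -(size_map pickle J); exact: unit_measure_digits.
Qed.
End FairCoins.

(** * Laws of binary processes and the block process *)

Section Laws.
Context {R : realType} {d : measure_display} {T : measurableType d}
  (P : probability T R).

Lemma measurable_realization (B : int -> T -> bool) (E : set (int -> bool)) :
  (forall i, finite_rv (B i)) -> seq_sigma E -> measurable (realization B @^-1` E).
Proof.
move=> mB mE.
have mf : measurable_fun setT (realization B : T -> binseq).
  apply: (@measurability _ _ T binseq setT _
    [set C | exists (i : int) (a : bool), C = [set z : int -> bool | z i = a]]) =>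
    // _ [_ [i [a ->]] <-].
  rewrite setTI; exact: mB.
by have := mf measurableT E mE; rewrite setTI.
Qed.

Definition cylinder (J : seq int) (z : int -> bool) : set (int -> bool) :=
  [set x | forall i, i \in J -> x i = z i].

Lemma measurable_cylinder J z : seq_sigma (cylinder J z).
Proof.
rewrite seq_sigmaE (_ : cylinder J z =
  \bigcap_(i in [set` J]) [set x : binseq | x i = z i]); last first.
  by apply/seteqP; split.
by apply: fin_bigcap_measurable => // i _; exact: measurable_coord.
Qed.

(** Dynkin's pi-lambda theorem: cylinders, with the empty set, are stable under
    intersection and generate the sigma-algebra. *)
Lemma eq_law_cylinder (C C' : set T) (B B' : int -> T -> bool) :
  measurable C -> measurable C' ->
  (forall i, finite_rv (B i)) -> (forall i, finite_rv (B' i)) ->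
  (forall J z, uniq J -> P (C `&` realization B @^-1` cylinder J z) =
                         P (C' `&` realization B' @^-1` cylinder J z)) ->
  forall E, seq_sigma E -> P (C `&` realization B @^-1` E) =
                           P (C' `&` realization B' @^-1` E).
Proof.
move=> mC mC' mB mB' BB'.
pose G : set (set (int -> bool)) := [set E | E = set0 \/ exists J z, E = cylinder J z].
pose D : set (set (int -> bool)) := [set E | seq_sigma E /\
  P (C `&` realization B @^-1` E) = P (C' `&` realization B' @^-1` E)].
have GI : setI_closed G.
  move=> E F [->|[J [z ->]]]; first by rewrite set0I; left.
  move=> [->|[K [y ->]]]; first by rewrite setI0; left.
  have [[x [xJ xK]]|/forallNP none] := pselect (exists x, (cylinder J z `&` cylinder K y) x).
    (* two cylinders with a common point x are both cylinders around x *)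
    right; exists (J ++ K), x; apply/seteqP; split => t /=.
      move=> [tJ tK] i; rewrite mem_cat => /orP[iJ|iK].
        by rewrite tJ// xJ.
      by rewrite tK// xK.
    move=> h; split=> i iJ.
      by rewrite h ?mem_cat ?iJ// xJ.
    by rewrite h ?mem_cat ?iJ ?orbT// xK.
  by left; rewrite -subset0 => x /none.
have GD : G `<=` D.
  move=> _ [->|[J [z ->]]].
    split; last by rewrite !preimage_set0 !setI0.
    exact: (@measurable0 _ binseq).
  split; first exact: measurable_cylinder.
  have -> : cylinder J z = cylinder (undup J) z.
    by rewrite /cylinder; apply/seteqP; split => x /= h i ; have := h i; rewrite mem_undup.
  by apply: BB'; exact: undup_uniq.
have mS (A : set T) (K : int -> T -> bool) F : measurable A ->
    (forall i, finite_rv (K i)) -> seq_sigma F ->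
    measurable (A `&` realization K @^-1` F).
  by move=> mA mK mF; apply: measurableI => //; exact: (measurable_realization mK mF).
have dD : dynkin D.
  have DT : D setT.
    split; first exact: (@measurableT _ binseq).
    have := GD (cylinder [::] (fun=> true)).
    rewrite (_ : cylinder _ _ = setT); last by apply/seteqP; split.
    by move=> h; apply h; right; exists [::], (fun=> true); apply/seteqP; split.
  split=> //.
  - move=> E [mE PE]; split; first exact: (@measurableC _ binseq).
    have H (A : set T) (K : int -> T -> bool) : measurable A -> (forall i, finite_rv (K i)) ->
      P (A `&` realization K @^-1` (~` E)) = (P A - P (A `&` realization K @^-1` E))%E.
      move=> mA mK; rewrite preimage_setC -setDE measureD//.
        exact: measurable_realization.
      by rewrite ltey_eq fin_num_measure.
    rewrite !H// PE; congr (_ - _)%E.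
    by move: DT => [_]; rewrite !preimage_setT !setIT.
  - move=> F tF DF; split.
      by apply: (@bigcupT_measurable _ binseq) => i; have [] := DF i.
    have H (A : set T) (K : int -> T -> bool) : measurable A -> (forall i, finite_rv (K i)) ->
      P (A `&` realization K @^-1` (\bigcup_k F k)) =
      (\sum_(0 <= k <oo) P (A `&` realization K @^-1` (F k)))%E.
      move=> mA mK; rewrite preimage_bigcup setI_bigcupr measure_bigcup.
      - by apply: eq_eseriesl => k; rewrite in_setT.
      - by move=> k _; apply: mS => //; have [] := DF k.
      - by move=> i j _ _ [w [[_ Fi] [_ Fj]]]; apply: tF => //; exists (realization K w).
    rewrite !H//; apply: eq_eseriesr => k _; by have [] := DF k.
move=> E mE; suff [] : D E by [].
have : <<d G>> `<=` D by exact: smallest_sub.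
apply.
rewrite setI_closed_g_dynkin_g_sigma_algebra//.
move: E mE; apply: sub_sigma_algebra2 => _ [i [a ->]]; right.
exists [:: i], (fun=> a); apply/seteqP; split => x /=.
  by move=> xi j; rewrite inE => /eqP->.
by apply; rewrite inE.
Qed.

Lemma total_probability (A : finType) (V : T -> A) (E : set T) :
  finite_rv V -> measurable E -> P E = (\sum_a P (V @^-1` [set a] `&` E))%E.
Proof.
move=> mV mE.
have mF a : measurable (V @^-1` [set a] `&` E) by exact: measurableI.
have tF : trivIset setT (fun a => V @^-1` [set a] `&` E).
  by move=> a b _ _ [w [[/= <- _] [/= <- _]]].
rewrite [in LHS](_ : E = \bigcup_(a in [set: A]) (V @^-1` [set a] `&` E)).
  rewrite measure_fin_bigcup//; last exact: finite_finset.
  rewrite fsbig_finite/=; last exact: finite_finset.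
  apply: perm_big; apply: uniq_perm; rewrite ?index_enum_uniq ?finmap.fset_uniq//.
  move=> a; rewrite mem_index_enum in_fset_set; last exact: finite_finset.
  exact: mem_set.
by apply/seteqP; split=> [w Ew|w [a _ []]//]; exists (V w).
Qed.
End Laws.

Lemma measurable_reindex (f : int -> int) (E : set (int -> bool)) :
  seq_sigma E -> seq_sigma [set z : int -> bool | E (fun i => z (f i))].
Proof.
move=> mE.
apply: (@measurable_realization _ binseq (fun i (z : binseq) => z (f i)) E) => //.
by move=> i a; exact: measurable_coord.
Qed.

Section BlockProcess.
Context {R : realType} {d : measure_display} {T : measurableType d}
  (P : probability T R) (L : nat) (ph : T -> 'I_L.+1) (B : int -> T -> bool).
Hypothesis fair : fair_coins P ph B.

(** The number of the block that contains i, when block 0 starts at - q. *)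
Definition block_index (q : nat) (i : int) : int := ((i + q%:Z) %/ L.+1%:Z)%Z.

Definition block_process (C : int -> T -> bool) (i : int) (w : T) : bool :=
  C (block_index (ph w) i) w.

Definition coin_change (s : int -> int) (e : int -> bool) (i : int) (w : T) : bool :=
  B (s i) w (+) e i.

Lemma finite_rv_coin_change s e i : finite_rv (coin_change s e i).
Proof. exact: (finite_rv_comp (fun b => b (+) e i) (finite_rv_coins fair (s i))). Qed.

(** Relabelling the coins injectively and flipping some of them changes neither
    their joint law nor their independence of the phase.  It is used with the
    shift of the labels, with a single flip, and with the identity to compare
    two values of the phase. *)
Lemma coin_change_law (s s' : int -> int) (e : int -> bool) p p' E :
  cancel s s' -> seq_sigma E ->
  P (ph @^-1` [set p] `&` realization (coin_change s e) @^-1` E) =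
  P (ph @^-1` [set p'] `&` realization B @^-1` E).
Proof.
move=> ss'; apply: eq_law_cylinder; try exact: (finite_rv_phase fair).
- exact: finite_rv_coin_change.
- exact: (finite_rv_coins fair).
move=> J z uJ.
have := fair_cylinder fair p' z uJ; rewrite /realization /cylinder /= => ->.
have uJ' : uniq (map s J) by rewrite map_inj_uniq//; exact: can_inj ss'.
have := fair_cylinder fair p (fun j => z (s' j) (+) e (s' j)) uJ'.
rewrite size_map => <-; congr (P (_ `&` _)); apply/seteqP; split => w /= h.
  move=> _ /mapP[i iJ ->]; rewrite ss' -h// /coin_change.
  by rewrite -addbA addbb addbF.
move=> i iJ; rewrite /coin_change h ?map_f// ss'.
by rewrite -addbA addbb addbF.
Qed.

Lemma finite_rv_block_process C i : (forall i, finite_rv (C i)) -> finite_rv (block_process C i).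
Proof.
move=> mC a.
rewrite (_ : _ @^-1` _ = \bigcup_(p in [set: 'I_L.+1])
   (ph @^-1` [set p] `&` C (block_index p i) @^-1` [set a])).
  apply: fin_bigcup_measurable => [|p _]; first exact: finite_finset.
  by apply: measurableI; [exact: (finite_rv_phase fair)|exact: mC].
apply/seteqP; split => [w Xw|w [p _ [/= <- <-]]//].
by exists (ph w).
Qed.

Lemma block_process_law C E : (forall i, finite_rv (C i)) -> seq_sigma E ->
  P (realization (block_process C) @^-1` E) =
  (\sum_p P (ph @^-1` [set p] `&`
    realization C @^-1` [set z | E (fun i => z (block_index p i))]))%E.
Proof.
move=> mC mE; rewrite (total_probability P (finite_rv_phase fair)); last first.
  apply: measurable_realization => // i; exact: finite_rv_block_process.
by apply: eq_bigr => p _; congr (P _); apply/seteqP; split => w /= [<- h].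
Qed.

(** Shifting time by one raises the phase by one, and the phase L.+1 is the
    phase 0 with the coins relabelled. *)
Lemma block_process_stationary : stationary P (block_process B).
Proof.
move=> E mE; have mB := finite_rv_coins fair.
have mE' : seq_sigma (@seq_shift bool @^-1` E) by exact: (measurable_reindex (fun i => i + 1)).
rewrite !block_process_law//.
pose h q := P (ph @^-1` [set ord0] `&`
    realization B @^-1` [set z | E (fun i => z (block_index q i))]).
have mEq q : seq_sigma [set z : int -> bool | E (fun i => z (block_index q i))].
  exact: measurable_reindex.
have coinB : B = coin_change id (fun=> false).
  by apply/funext => i; apply/funext => w; rewrite /coin_change addbF.
have hE p q : P (ph @^-1` [set p] `&`
    realization B @^-1` [set z | E (fun i => z (block_index q i))]) = h q.
  by rewrite {1}coinB (@coin_change_law id id _ _ ord0).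
have hL : h L.+1 = h 0%N.
  rewrite /h -[RHS](@coin_change_law (fun i => i + 1) (fun i => i - 1)
    (fun=> false) ord0)//; last first.
    by move=> i; rewrite addrK.
  have indexL i : block_index L.+1 i = block_index 0 i + 1.
    by rewrite /block_index addr0 divzDr ?dvdzz// divzz.
  congr (P (_ `&` _)); apply/funext => w /=; congr E; apply/funext => i.
  by rewrite /realization /coin_change addbF indexL.
transitivity (\sum_(p < L.+1) h p.+1)%E.
  apply: eq_bigr => p _; rewrite -(hE p); congr (P (_ `&` _)).
  apply/funext => w /=; congr E; apply/funext => i.
  by rewrite /seq_shift /block_index; congr (B (_ %/ _)%Z _); lia.
under [RHS]eq_bigr do rewrite hE.
by rewrite big_ord_recr/= hL addeC big_ord_recl.
Qed.

Lemma block_process_flip_law e E : seq_sigma E ->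
  P (realization (block_process (coin_change id e)) @^-1` E) =
  P (realization (block_process B) @^-1` E).
Proof.
move=> mE; rewrite !block_process_law//; last 2 first.
- exact: (finite_rv_coins fair).
- by move=> i; exact: finite_rv_coin_change.
apply: eq_bigr => p _; apply: (@coin_change_law id id) => //.
exact: measurable_reindex.
Qed.
End BlockProcess.

(** * Conditional probabilities and vanishing conditional entropy *)

Lemma measurable_fine_preimage (R : realType) (B : set R) :
  measurable B -> measurable ((@fine R : \bar R -> R) @^-1` B).
Proof.
by move=> mB; rewrite -[_ @^-1` _]setTI; exact: fine_measurable.
Qed.

Lemma measurable_eta (R : realType) : measurable_fun setT (@eta R).
Proof.
apply: measurableT_comp => //; exact: measurable_funM.
Qed.

Section ConditionalProbability.
Context {R : realType} {d : measure_display} {T : measurableType d}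
  (P : probability T R) (G : set (set T)).
Hypothesis mG : forall C, G C -> measurable C.

Lemma sub_sigma_measurable C : <<s G >> C -> measurable C.
Proof. by apply: smallest_sub; [exact: sigma_algebra_measurable|exact: mG]. Qed.

(** Radon-Nikodym on the coarser sigma-algebra, for the restriction of P to E
    against P. *)
Lemma cond_prob_ex E : measurable E -> exists g, is_cond_prob P <<s G >> E g.
Proof.
move=> mE.
pose S := g_sigma_algebraType G.
have mid : measurable_fun setT (id : T -> S).
  by move=> _ C mC; rewrite setTI; exact: sub_sigma_measurable.
pose f : T -> S := id.
pose mu : {measure set S -> \bar R} := pushforward P f.
pose nu : {measure set S -> \bar R} := pushforward (mrestr P mE) f.
have mufin : fin_num_fun (mu mid).
  move=> A /sub_sigma_measurable mA; change (P A \is a fin_num).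
  by rewrite fin_num_measure.
pose mu' : {finite_measure set S -> \bar R} :=
  HB.pack (Measure.sort (mu mid)) (Measure_isFinite.Build _ _ _ (Measure.sort (mu mid)) mufin).
have nufin : fin_num_fun (nu mid).
  move=> A /sub_sigma_measurable mA; change (P (A `&` E) \is a fin_num).
  by rewrite fin_num_measure//; exact: measurableI.
pose nu' : {finite_measure set S -> \bar R} :=
  HB.pack (Measure.sort (nu mid)) (Measure_isFinite.Build _ _ _ (Measure.sort (nu mid)) nufin).
have numu : nu' `<< mu'.
  apply/null_content_dominatesP => A mA A0.
  apply: (@subset_measure0 _ _ _ P _ A) => //.
    by apply: measurableI => //; exact: sub_sigma_measurable.
  exact: sub_sigma_measurable.
have [h [h0 hfin hint hE]] := radon_nikodym_sigma_finite numu.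
have mh := measurable_int _ hint.
pose k : T -> \bar R := h.
exists (fine \o k).
have fineh : EFin \o (fine \o k) = k by apply/funext => x /=; rewrite fineK.
have IE C : <<s G>> C -> (\int[P]_(w in C) k w)%E = P (E `&` C).
  move=> mC.
  have <- : (\int[pushforward P f]_(y in (C : set S)) h y = \int[P]_(w in C) k w)%E.
    apply: (ge0_integral_pushforward mid P mC) => [|x _]; last exact: h0.
    exact: (measurable_funS measurableT (@subsetT _ _) mh).
  by rewrite setIC; exact/esym/hE.
split.
- move=> B mB.
  have mfB := measurable_fine_preimage mB.
  by have := mh measurableT _ mfB; rewrite setTI.
- rewrite fineh; apply/integrableP; split.
    exact: (measurableT_comp mh mid).
  under eq_integral do rewrite gee0_abs//.
  have := IE setT (@measurableT _ S). move=> ->.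
  by rewrite ltey_eq fin_num_measure//; exact: measurableI.
- by move=> C mC; rewrite -[RHS]IE//; apply: eq_integral => x _; rewrite /= fineK.
Qed.

Lemma cond_probP E : measurable E -> is_cond_prob P <<s G >> E (cond_prob P <<s G >> E).
Proof. by move=> mE; have [g gP] := cond_prob_ex mE; exact: (xgetI _ gP). Qed.

Lemma measurable_cond_prob E (g : T -> R) : is_cond_prob P <<s G >> E g ->
  measurable_fun setT g.
Proof.
by move=> [Gg _ _] _ B mB; rewrite setTI; apply: sub_sigma_measurable; exact: Gg.
Qed.

(** On the set N of G where g exceeds 1, the integral of g is P (E `&` N) <= P N,
    so that the positive function g - 1 has integral 0 there. *)
Lemma cond_prob_le1 E g : measurable E -> is_cond_prob P <<s G >> E g ->
  {ae P, forall w, g w <= 1}.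
Proof.
move=> mE gP; have mg := measurable_cond_prob gP; have [Gg ig gE] := gP.
pose N := g @^-1` `]1, +oo[%classic.
have GN : <<s G >> N by apply: Gg; exact: measurable_itv.
have mN : measurable N by exact: sub_sigma_measurable.
have iN : P.-integrable N (EFin \o g) by exact: integrableS ig.
have i1 : P.-integrable N (cst 1%E).
  by apply: finite_measure_integrable_cst.
have : (\int[P]_(w in N) `|(g w)%:E - 1| = 0)%E.
  apply/eqP; rewrite eq_le integral_ge0// andbT.
  rewrite (eq_integral (fun w => (g w)%:E - 1)%E); last first.
    move=> w /set_mem; rewrite /N/= in_itv/= andbT => g1.
    by rewrite -[LHS]/(`|(g w)%:E - 1|)%E gee0_abs// -EFinB lee_fin subr_ge0 ltW.
  rewrite integralB//= gE// integral_cst// mul1e sube_le0 ?fin_num_measure//.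
  by apply: le_measure; rewrite ?inE//; exact: measurableI.
move/ae_eq_integral_abs => h.
have mgN : measurable_fun N (fun w => (g w)%:E - 1)%E.
  by apply: emeasurable_funB => //; apply/measurable_EFinP; exact: measurable_funTS.
have {}h := h mN mgN.
apply: filterS h => w /= h; rewrite leNgt; apply/negP => g1.
have : ((g w)%:E - 1 = 0)%E by apply: h; rewrite /N/= in_itv/= g1.
by move=> -[] /eqP; rewrite subr_eq0 => /eqP g11; rewrite g11 ltxx in g1.
Qed.

(** Let g be the conditional probability of V = a.  The integrand is almost
    everywhere nonnegative, because g <= 1 for each a, hence it vanishes.  Since [eta] vanishes on ]-oo, 1] only for nonpositive arguments and
    at 1, g is almost everywhere 1 or nonpositive, and the event C where it is 1
    agrees with the event V = a up to a null set. *)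
Lemma cond_entropy_eq0 (A : finType) (V : T -> A) : finite_rv V ->
  cond_entropy P <<s G >> V = 0%E ->
  forall a, exists C, [/\ <<s G >> C, P (V @^-1` [set a] `\` C) = 0%E &
                          P (C `\` V @^-1` [set a]) = 0%E].
Proof.
move=> mV H0 a.
pose g b := cond_prob P <<s G >> (V @^-1` [set b]).
have gP b : is_cond_prob P <<s G >> (V @^-1` [set b]) (g b) by exact: cond_probP.
have mg b : measurable_fun setT (g b) := measurable_cond_prob (gP b).
have g1 : {ae P, forall w, forall b, g b w <= 1}.
  by apply: filter_forall => b; apply: cond_prob_le1 (gP b).
have mh : measurable_fun setT (fun w => (\sum_b eta (g b w))%:E).
  apply/measurable_EFinP; apply: measurable_sum => b.
  exact: (measurableT_comp (@measurable_eta R) (mg b)).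
have eta0 : {ae P, forall w, eta (g a w) = 0}.
  have : (\int[P]_(w in setT) `|(\sum_b eta (g b w))%:E| = 0)%E.
    rewrite -[RHS]H0; apply: ae_eq_integral => //.
      exact: measurableT_comp.
    apply: filterS g1 => w g1 _ /=; rewrite ger0_norm// sumr_ge0// => b _.
    exact: eta_ge0.
  move=> /(ae_eq_integral_abs _ measurableT mh).
  apply: filterS2 g1 => w g1 /(_ I) [] /eqP; rewrite psumr_eq0.
    by move=> /allP/(_ a); rewrite mem_index_enum => /(_ isT)/eqP.
  by move=> b _; exact: eta_ge0.
pose C := g a @^-1` [set 1].
have GC : <<s G >> C by have [h _ _] := gP a; exact: h.
have mC := sub_sigma_measurable GC.
have [_ ig gE] := gP a.
exists C; split=> //.
- have GnC : <<s G >> (~` C) by exact: (@measurableC _ (g_sigma_algebraType G)).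
  suff : (\int[P]_(w in ~` C) (g a w)%:E <= 0)%E.
    by rewrite gE// setDE measure_le0 => /eqP.
  have mnC : measurable (~` C) by exact: measurableC.
  pose g' w := Num.min (g a w) 0.
  have mg' : measurable_fun setT g' by exact: measurable_minr.
  rewrite (ae_eq_integral (EFin \o g'))//=.
  - have g'0 w : 0 <= - g' w by rewrite oppr_ge0 ge_min lexx orbT.
    rewrite (eq_integral (fun w => - (- g' w)%:E)%E); last first.
      by move=> w _; rewrite -EFinN opprK.
    rewrite integral_ge0N; last by move=> w _; rewrite lee_fin.
    by rewrite oppe_le0 integral_ge0// => w _; rewrite lee_fin.
  - by apply/measurable_EFinP; exact: measurable_funTS.
  - by apply/measurable_EFinP; exact: measurable_funTS.
  - apply: filterS eta0 => w /eqP; rewrite oppr_eq0 mulf_eq0 => h nCw.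
    have [g0|gpos] := leP (g a w) 0; first by rewrite /g'/= min_l.
    move: h; rewrite gt_eqF//= ln_eq0// => /eqP gw1.
    by case: nCw.
- have PD : P (C `\` V @^-1` [set a]) = (P C - P (V @^-1` [set a] `&` C))%E.
    by rewrite setIC; apply: measureD => //; rewrite ltey_eq fin_num_measure.
  have PC : P C = P (V @^-1` [set a] `&` C).
    rewrite -gE// (eq_integral (cst 1%E)); first by rewrite integral_cst// mul1e.
    by move=> w /set_mem; rewrite /C/= => ->.
  by rewrite PD PC subee// fin_num_measure//; exact: measurableI.
Qed.
End ConditionalProbability.

(** * The block process is not bilaterally deterministic *)

Section NotDeterministic.
Context {R : realType} {d : measure_display} {T : measurableType d}
  (P : probability T R) (L : nat) (ph : T -> 'I_L.+1) (B : int -> T -> bool).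
Hypothesis fair : fair_coins P ph B.

Let X := block_process ph B.
Let flip (j : int) : bool := j == 1.
(** X' is X with the coin of block 1 flipped; the window [0, k] with k below
    contains that block for every value of the phase. *)
Let X' := block_process ph (coin_change B id flip).
Let k := (2 * L.+1)%N.
Let outside := [set i : int | i <= -1 \/ k%:Z + 1 <= i].

Lemma finite_rv_fair_blocks i : finite_rv (X i).
Proof. by apply: (finite_rv_block_process fair) => j; exact: (finite_rv_coins fair). Qed.

Lemma flip_outside i w : outside i -> X' i w = X i w.
Proof.
rewrite /outside/= => oi; rewrite /X' /X /block_process /coin_change /flip.
rewrite (_ : _ == 1 = false) ?addbF//; apply/negbTE/eqP.
rewrite /block_index /k in oi *; have := ltn_ord (ph w).
move: (nat_of_ord (ph w)) => p pL pi.
have h1 := divz_eq (i + p%:Z) L.+1%:Z.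
have h2 := modz_ge0 (i + p%:Z) (_ : L.+1%:Z != 0).
have h3 := ltz_pmod (i + p%:Z) (_ : 0 < L.+1%:Z).
rewrite pi mul1r in h1.
have {}h2 := h2 isT; have {}h3 := h3 isT.
case: oi => oi; lia.
Qed.

(** X and X' agree outside the window, so an event observed there has the same
    description in terms of either process. *)
Lemma outside_event C : sigma_process X outside C ->
  exists2 E, seq_sigma E & realization X @^-1` E = C /\ realization X' @^-1` E = C.
Proof.
rewrite /sigma_process => sC.
pose S : set (set T) := [set C | exists2 E, seq_sigma E &
  realization X @^-1` E = C /\ realization X' @^-1` E = C].
suff : sigma_algebra setT S /\ [set C | exists (i : int) (a : bool), outside i /\
    C = X i @^-1` [set a]] `<=` S by move=> [h1 h2]; exact: (smallest_sub h1 h2).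
split; last first.
  move=> _ [i [a [oi ->]]]; exists [set z | z i = a]; first exact: measurable_coord.
  split=> //; apply/seteqP; split => w /=; rewrite /realization flip_outside//.
split.
- exists set0; first exact: (@measurable0 _ binseq).
  by rewrite !preimage_set0.
- move=> A [E mE [EA E'A]]; exists (~` E); first exact: (@measurableC _ binseq).
  by split; rewrite preimage_setC setTD; congr (~` _); [exact: EA|exact: E'A].
- move=> F SF; have /choice[E hE] : forall n, exists E, seq_sigma E /\
    (realization X @^-1` E = F n /\ realization X' @^-1` E = F n).
    by move=> n; have [E mE EF] := SF n; exists E.
  exists (\bigcup_n E n).
    by apply: (@bigcupT_measurable _ binseq) => n; have [] := hE n.
  split; rewrite preimage_bigcup; apply: eq_bigcupr => n _; have [_ [h h']] := hE n.
    exact: h.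
  exact: h'.
Qed.

(** Let F say that the window is filled with ones.  If X in F were almost surely
    the outside event C, then by equality of laws X' in F would be almost surely
    contained in C, hence in X in F.  These two events are disjoint, since X and
    X' differ on block 1, so both would be null; but X is constantly 1 on the
    window as soon as the phase is 0 and the coins 0, 1, 2 are 1. *)
Lemma block_process_not_deterministic : ~ bilaterally_deterministic P X.
Proof.
move=> /(_ k) H.
pose V := block X 0 k.+1; pose a : {ffun 'I_k.+1 -> bool} := [ffun=> true].
pose F : set (int -> bool) := [set z | forall j : 'I_k.+1, z (0 + (j : nat)%:Z) = true].
have mF : seq_sigma F.
  rewrite seq_sigmaE (_ : F = \bigcap_(j in [set: 'I_k.+1])
    [set z : binseq | z (0 + (j : nat)%:Z) = true]); last first.
    by apply/seteqP; split=> z h j; [move=> _|]; exact: h.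
  by apply: fin_bigcap_measurable => // j _; exact: measurable_coord.
have VF : V @^-1` [set a] = realization X @^-1` F.
  apply/seteqP; split=> w /=.
    by move=> Vw j; have := congr1 (fun f : {ffun _ -> _} => f j) Vw; rewrite !ffunE.
  by move=> h; apply/ffunP => j; rewrite !ffunE; exact: h.
have mV : finite_rv V by apply: finite_rv_block; exact: finite_rv_fair_blocks.
have mX' i : finite_rv (X' i).
  by apply: (finite_rv_block_process fair) => j; exact: (finite_rv_coin_change fair).
have mG C : [set C | exists (i : int) (a : bool), outside i /\
    C = X i @^-1` [set a]] C -> measurable C.
  by move=> [i [b [_ ->]]]; exact: finite_rv_fair_blocks.
have [C [GC VC CV]] := cond_entropy_eq0 mG mV H a.
have [E mE [XE X'E]] := outside_event GC.
have mC : measurable C := sub_sigma_measurable mG GC.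
have mFE : seq_sigma (F `\` E) by exact: (@measurableD _ binseq _ _ mF mE).
have mX'F : measurable (realization X' @^-1` F) by exact: measurable_realization.
have X'C : P (realization X' @^-1` F `\` C) = 0%E.
  (* the law of X' charges F minus E as much as the law of X does *)
  rewrite -[in LHS]X'E -VC VF -[in RHS]XE.
  exact: (block_process_flip_law fair flip mFE).
have disj : realization X' @^-1` F `&` V @^-1` [set a] = set0.
  rewrite VF -subset0 => w [/= X'w Xw].
  have pL := ltn_ord (ph w).
  have jk : (L.+1 - ph w < k.+1)%N by rewrite /k; lia.
  have := X'w (Ordinal jk); have := Xw (Ordinal jk).
  rewrite /realization /X /X' /block_process /coin_change /flip /=.
  have -> : block_index L (ph w) (0 + Posz (L.+1 - ph w)%N) = 1.
    by rewrite /block_index -subzn 1?ltnW// add0r subrK divzz.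
  by move=> ->.
have X'0 : P (realization X' @^-1` F) = 0%E.
  have : (P (realization X' @^-1` F) <=
      P ((realization X' @^-1` F `\` C) `|` (C `\` V @^-1` [set a])))%E.
    apply: le_measure; rewrite ?inE//.
      by apply: measurableU; exact: measurableD.
    move=> w X'w; have [Cw|nCw] := pselect (C w); [right|by left].
    by split=> // Vw; have : set0 w by rewrite -disj.
  have hU : (P ((realization X' @^-1` F `\` C) `|` (C `\` V @^-1` [set a])) <=
      P (realization X' @^-1` F `\` C) + P (C `\` V @^-1` [set a]))%E.
    by apply: measureU2; exact: measurableD.
  rewrite X'C CV adde0 in hU.
  by move=> /le_trans/(_ hU); rewrite measure_le0 => /eqP.
have := fair_cylinder fair ord0 (fun=> true) (isT : uniq [:: 0 : int; 1; 2%:Z]).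
move=> pos.
have : (0 < P (realization X @^-1` F))%E.
  apply: (@lt_le_trans _ _ (L.+1%:R^-1 * (2 ^ 3)%:R^-1)%:E).
    by rewrite lte_fin mulr_gt0// invr_gt0.
  rewrite -pos; apply: le_measure; rewrite ?inE.
  - apply: measurableI; first exact: (finite_rv_phase fair).
    rewrite (_ : [set w | _] = realization B @^-1` cylinder [:: 0 : int; 1; 2%:Z] (fun=> true))//.
    by apply: measurable_realization; [exact: (finite_rv_coins fair)|exact: measurable_cylinder].
  - by rewrite -VF.
  move=> w [/= p0 Bw] j; rewrite /realization /X /block_process p0; apply: Bw.
  rewrite /block_index/= add0r addr0.
  have := ltn_ord j; move: (nat_of_ord j) => i; rewrite /k => ik.
  rewrite divz_nat !inE.
  have : (i %/ L.+1 <= 2)%N by rewrite -ltnS ltn_divLR//; lia.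
  by case: (_ %/ _)%N => [|[|[|]]].
rewrite -(block_process_flip_law fair flip mF) -/X' X'0 ltxx//.
Qed.
End NotDeterministic.

(** * Entropy of the masked block process *)

Section Decoding.
Context {R : realType} {d : measure_display} {T : measurableType d}
  (P : probability T R) (L : nat) (ph : T -> 'I_L.+1) (B : int -> T -> bool)
  (Y : int -> T -> bool).
Hypotheses (fair : fair_coins P ph B) (mY : forall i, finite_rv (Y i)).
Hypothesis progression :
  {ae P, forall w, exists a : int, forall k : int, Y (a + L.+1%:Z * k) w}.

Let X := block_process ph B.
Let M i w := X i w && Y i w.

Let sX i : finite_rv (X i).
Proof. by apply: (finite_rv_block_process fair) => j; exact: (finite_rv_coins fair). Qed.

Lemma finite_rv_masked i : finite_rv (M i).
Proof. exact: (finite_rv_comp (fun p => p.1 && p.2) (finite_rv_pair (sX i) (mY i))). Qed.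

Definition full_residues (w : T) : {ffun 'I_L.+1 -> bool} :=
  [ffun r : 'I_L.+1 => `[< forall k : int, Y ((r : nat)%:Z + L.+1%:Z * k) w >]].

(** Some residue modulo L.+1 whose whole class consists of return times; the
    default [ord0] occurs only on a null set. *)
Definition residue (w : T) : 'I_L.+1 :=
  odflt ord0 [pick r | full_residues w r].

Lemma finite_rv_residue : finite_rv residue.
Proof.
apply: (finite_rv_comp (fun f : {ffun 'I_L.+1 -> bool} => odflt ord0 [pick r | f r])).
move=> f; pose D (r : 'I_L.+1) := [set w | forall k : int, Y ((r : nat)%:Z + L.+1%:Z * k) w].
have mD r : measurable (D r).
  (* an intersection over the integers, made countable by [pickle] *)
  rewrite (_ : D r = \bigcap_(n in [set: nat])
    [set w | forall k : int, unpickle n = Some k ->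
      Y ((r : nat)%:Z + L.+1%:Z * k) w]); last first.
    apply/seteqP; split => w /=; first by move=> h n _ k _; exact: h.
    by move=> h k; apply: (h (pickle k)) => //; exact: pickleK.
  apply: bigcapT_measurable => n; case: (unpickle n) => [k|].
    rewrite (_ : [set w | _] = Y ((r : nat)%:Z + L.+1%:Z * k) @^-1` [set true]); first exact: mY.
    by apply/seteqP; split => w /= => [|h k' [<-]//]; apply.
  by rewrite (_ : [set w | _] = setT)//; apply/seteqP; split.
rewrite (_ : _ @^-1` _ = \bigcap_(r in [set: 'I_L.+1]) (if f r then D r else ~` D r)).
  by apply: fin_bigcap_measurable => // r _; case: (f r) => //; exact: measurableC.
apply/seteqP; split => w /=.
  by move=> <- r _; rewrite ffunE; case: asboolP.
move=> h; apply/ffunP => r; rewrite ffunE; have := h r I.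
by case: (f r) => hr; apply/asboolP.
Qed.

Lemma residueP w : (exists a : int, forall k : int, Y (a + L.+1%:Z * k) w) ->
  forall k : int, Y ((residue w : nat)%:Z + L.+1%:Z * k) w.
Proof.
move=> [a ha]; rewrite /residue; case: pickP => [r /=|none].
  by rewrite ffunE => /asboolP.
have m0 := modz_ge0 a (isT : L.+1%:Z != 0); have mL := ltz_pmod a (isT : 0 < L.+1%:Z).
have rL : (`|(a %% L.+1%:Z)%Z| < L.+1)%N by rewrite -ltz_nat gez0_abs.
have /negP[] := none (Ordinal rL); rewrite ffunE; apply/asboolP => k.
rewrite /= gez0_abs//.
have -> : (a %% L.+1%:Z)%Z + L.+1%:Z * k = a + L.+1%:Z * (k - (a %/ L.+1%:Z)%Z).
  by rewrite {2}(divz_eq a L.+1%:Z); ring.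
exact: ha.
Qed.

(** The point congruent to a modulo L.+1 in the block of i, for the phase p:
    the block starts at L.+1 * block_index p i - p. *)
Definition sample_point (p a : nat) (i : int) : int :=
  L.+1%:Z * block_index L p i - p%:Z + ((a%:Z + p%:Z) %% L.+1%:Z)%Z.

Lemma block_index_sample p a i : block_index L p (sample_point p a i) = block_index L p i.
Proof.
rewrite {1}/block_index /sample_point addrAC subrK [L.+1%:Z * _]mulrC divzMDl//.
rewrite divz_small ?addr0// modz_ge0//= ltz_pmod//.
Qed.

Lemma sample_pointE p a i : exists k, sample_point p a i = a%:Z + L.+1%:Z * k.
Proof.
exists (block_index L p i - ((a%:Z + p%:Z) %/ L.+1%:Z)%Z).
rewrite /sample_point; have h := divz_eq (a%:Z + p%:Z) L.+1%:Z.
apply/eqP; rewrite -subr_eq0; apply/eqP.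
transitivity (((a%:Z + p%:Z) %/ L.+1%:Z)%Z * L.+1%:Z +
  ((a%:Z + p%:Z) %% L.+1%:Z)%Z - (a%:Z + p%:Z)).
  by ring.
by rewrite -h subrr.
Qed.

Lemma block_index_mono p i j : i <= j -> block_index L p i <= block_index L p j.
Proof. by move=> ij; apply: lez_pdiv2r => //; rewrite lerD2r. Qed.

(** What must be known besides the masked process to recover X on [0, n[.  The
    alphabet of this variable does not depend on n. *)
Definition boundary n (w : T) : 'I_L.+1 * 'I_L.+1 * (bool * bool) :=
  ((ph w, residue w), (X 0 w, X n.-1%:Z w)).

(** Read X at the sample point of the block of i when that point lies in [0, n[.
    When it is negative the block of i contains 0, and when it is at least n the
    block of i contains n.-1. *)
Definition decode n (c : {ffun 'I_n -> bool} * ('I_L.+1 * 'I_L.+1 * (bool * bool)))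
    : {ffun 'I_n -> bool} :=
  [ffun i : 'I_n =>
    match sample_point c.2.1.1 c.2.1.2 (i : nat)%:Z with
    | Posz j => if insub j is Some j' then c.1 j' else c.2.2.2
    | Negz _ => c.2.2.1
    end].

Lemma decodeP n w : (exists a : int, forall k : int, Y (a + L.+1%:Z * k) w) ->
  block X 0 n w = decode (block M 0 n w, boundary n w).
Proof.
move=> /residueP Yr; apply/ffunP => i; rewrite !ffunE/= add0r.
have := block_index_sample (ph w) (residue w) (i : nat)%:Z.
have [k jE] := sample_pointE (ph w) (residue w) (i : nat)%:Z.
have Yj : Y (sample_point (ph w) (residue w) (i : nat)%:Z) w by rewrite jE; exact: Yr.
move: Yj; case: (sample_point _ _ _) => [j|j] Yj jb.
  case: insubP => [j' _ j'E|].
    rewrite ffunE add0r j'E /M Yj andbT /X /block_process jb.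
    by [].
  rewrite -leqNgt => nj.
  have i_last : (i <= n.-1)%N by rewrite -ltnS (ltn_predK (ltn_ord i)).
  have last_j : (n.-1 <= j)%N by exact: leq_trans (leq_pred n) nj.
  rewrite /X /block_process; congr (B _ w); apply: le_anti; apply/andP; split.
    by apply: block_index_mono; rewrite lez_nat.
  by rewrite -jb; apply: block_index_mono; rewrite lez_nat.
rewrite /X /block_process; congr (B _ w); apply: le_anti; apply/andP; split.
  by rewrite -jb; apply: block_index_mono.
exact: block_index_mono.
Qed.

(** Up to a null set, the masked block together with the boundary data determines
    the block of X, and the entropy of the boundary data is at most the size of
    their alphabet. *)
Lemma entropy_masked_ge n : entropy P (block X 0 n) <=
  entropy P (block M 0 n) + #|{: 'I_L.+1 * 'I_L.+1 * (bool * bool)}|%:R.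
Proof.
have mM := finite_rv_masked.
have mV : finite_rv (boundary n).
  apply: finite_rv_pair; apply: finite_rv_pair => //; first exact: (finite_rv_phase fair).
  exact: finite_rv_residue.
have mMV : finite_rv (fun w => (block M 0 n w, boundary n w)).
  by apply: finite_rv_pair => //; exact: finite_rv_block.
rewrite (@eq_entropy _ _ _ P _ (block X 0 n) (@decode n \o fun w => (block M 0 n w, boundary n w))).
- apply: le_trans (entropy_comp_le P _ mMV) _.
  apply: (le_trans (entropy_pair_le P _ mV)); first exact: finite_rv_block.
  by rewrite lerD2l; exact: entropy_le_card.
- exact: finite_rv_block.
- exact: finite_rv_comp.
- by apply: filterS progression => w; exact: decodeP.
Qed.

Lemma entropy_masked_le n : entropy P (block M 0 n) <=
  entropy P (block X 0 n) + entropy P (block Y 0 n).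
Proof.
apply: (le_trans _ (entropy_pair_le P _ _)); [|exact: finite_rv_block..].
pose f (c : {ffun 'I_n -> bool} * {ffun 'I_n -> bool}) : {ffun 'I_n -> bool} :=
  [ffun i => c.1 i && c.2 i].
rewrite (_ : block M 0 n = f \o fun w => (block X 0 n w, block Y 0 n w)).
  by apply: entropy_comp_le; apply: finite_rv_pair; exact: finite_rv_block.
by apply/funext => w; apply/ffunP => i; rewrite !ffunE.
Qed.

(** The block entropies of X and of the masked process differ by at most
    H(Y_0, ..., Y_(n-1)) + C, which is o(n). *)
Lemma entropy_rate_masked :
  ((fun n : nat => n%:R^-1 * entropy P (block Y 0 n)) @ \oo --> (0 : R)) ->
  entropy_rate P M = entropy_rate P X.
Proof.
move=> Y0; have cX : cvgn (fun n : nat => n%:R^-1 * entropy P (block X 0 n)).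
  by apply: entropy_rate_cvg => //; exact: block_process_stationary.
pose c : R := #|{: 'I_L.+1 * 'I_L.+1 * (bool * bool)}|%:R.
have c0 : (fun n : nat => n%:R^-1 * c) @ \oo --> (0 : R).
  rewrite -[X in _ --> X](mul0r c); apply: cvgMr_tmp.
  by rewrite -cvg_shiftS; exact: cvg_harmonic.
apply/cvg_lim => //; rewrite /entropy_rate.
set l := limn _.
apply: (@squeeze_cvgr _ _ _ _ (fun n : nat => n%:R^-1 * entropy P (block X 0 n) - n%:R^-1 * c)
    (fun n : nat => n%:R^-1 * entropy P (block X 0 n) + n%:R^-1 * entropy P (block Y 0 n))).
- near=> n; rewrite -mulrBr -mulrDr !ler_wpM2l//.
    by rewrite entropy_masked_le.
  by rewrite lerBlDr entropy_masked_ge.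
- by rewrite -[X in _ --> X]subr0; apply: cvgB.
- by rewrite -[X in _ --> X]addr0; apply: cvgD.
Unshelve. all: by end_near. Qed.
End Decoding.

(** * Construction on the product space *)

Lemma fair_coins_comp (R : realType) (d d' : measure_display) (T : measurableType d)
    (T' : measurableType d') (P : probability T R) (P' : probability T' R)
    (q : T' -> T) (L : nat) (ph : T -> 'I_L.+1) (B : int -> T -> bool) :
  measurable_fun setT q -> (forall E, measurable E -> P' (q @^-1` E) = P E) ->
  fair_coins P ph B -> fair_coins P' (ph \o q) (fun i => B i \o q).
Proof.
move=> mq qP fair; have [mph mB law] := fair; split.
- exact: finite_rv_measurable_comp.
- by move=> i; exact: finite_rv_measurable_comp.
move=> p J a uJ; rewrite -(law p J a uJ) -qP//.
by apply: measurableI; [exact: mph|exact: (measurable_realization mB (measurable_cylinder J a))].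
Qed.

Lemma entropy_comp_preserving (R : realType) (d d' : measure_display) (T : measurableType d)
    (T' : measurableType d') (P : probability T R) (P' : probability T' R)
    (q : T' -> T) (A : finType) (V : T -> A) :
  (forall E, measurable E -> P' (q @^-1` E) = P E) -> finite_rv V ->
  entropy P' (V \o q) = entropy P V.
Proof. by move=> qP mV; apply: eq_bigr => a _; rewrite -qP. Qed.

Unset Implicit Arguments.

Theorem corollary1p19 (R : realType) (d : measure_display)
    (T : measurableType d) (P : probability T R) (Y : int -> T -> bool)
    (Ygood : good P Y) (Yergodic : ergodic P Y)
    (Yzero : entropy_rate P Y = 0)
    (Yprogression : exists L : nat, (1 <= L)%N /\
       {ae P, forall w, exists a : int, forall k : int, Y (a + L%:Z * k) w}) :
  (* an enlargement q : (T', P') -> (T, P) of the underlying space carries X *)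
  exists (d' : measure_display) (T' : measurableType d')
         (P' : probability T' R) (q : T' -> T),
    [/\ measurable_fun [set: T'] q,
        forall E : set T, measurable E -> P' (q @^-1` E) = P E &
        exists X : int -> T' -> bool,
          [/\ forall i, measurable_fun [set: T'] (X i),
              stationary P' X,
              independent_processes P' X (fun i w => Y i (q w)),
              ~ bilaterally_deterministic P' X &
              entropy_rate P' (fun i w => X i w && Y i (q w)) =
              entropy_rate P' X]].
Proof.
have [mY sY _ _] := Ygood.
have {}mY i : finite_rv (Y i).
  by move=> a; have := mY i measurableT [set a] I; rewrite setTI.
have [[|L] [//= _ prog]] := Yprogression.
have [d2 [Om [Q [ph [B fair]]]]] := @fair_coins_exist R L.
pose P' : probability (T * Om)%type R := (P \x Q)%E.
have fstP E : measurable E -> P' (fst @^-1` E) = P E.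
  move=> mE; rewrite (_ : fst @^-1` E = E `*` setT); last first.
    by apply/seteqP; split => w //= [].
  by transitivity (P E * Q setT)%E; [exact: product_measure1E|rewrite probability_setT mule1].
have sndQ E : measurable E -> P' (snd @^-1` E) = Q E.
  move=> mE; rewrite (_ : snd @^-1` E = setT `*` E); last first.
    by apply/seteqP; split => w //= [].
  by transitivity (P setT * Q E)%E; [exact: product_measure1E|rewrite probability_setT mul1e].
have fair' := fair_coins_comp measurable_snd sndQ fair.
have mB := finite_rv_coins fair.
pose X := block_process (ph \o snd) (fun i => B i \o (snd : T * Om -> Om)).
have mX i : finite_rv (X i) by exact: (finite_rv_fair_blocks fair').
have mY' i : finite_rv (Y i \o (fst : T * Om -> T)).
  exact: finite_rv_measurable_comp measurable_fst (mY i).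
exists _, (T * Om)%type, P', fst; split=> //.
exists X; split.
- by move=> i _ S _; rewrite setTI; exact: finite_rv_preimage.
- exact: (block_process_stationary fair').
- move=> E F mE mF.
  have mXE : measurable (realization (block_process ph B) @^-1` E).
    by apply: measurable_realization => // i; exact: (finite_rv_fair_blocks fair).
  have mYF : measurable (realization Y @^-1` F) by exact: measurable_realization.
  rewrite (_ : realization X @^-1` E = snd @^-1` (realization (block_process ph B) @^-1` E))//.
  rewrite (_ : realization _ @^-1` F = fst @^-1` (realization Y @^-1` F))//.
  rewrite sndQ// fstP// muleC.
  rewrite (_ : _ `&` _ = (realization Y @^-1` F) `*` (realization (block_process ph B) @^-1` E)).
    exact: product_measure1E.
  by rewrite setIC.
- exact: (block_process_not_deterministic fair').
- apply: (entropy_rate_masked fair' mY') => //.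
    have [N [mN N0 progN]] := prog; exists (fst @^-1` N); split.
    + by rewrite -[_ @^-1` _]setTI; exact: measurable_fst.
    + by rewrite fstP.
    + by move=> [w v] /= nprog; apply: progN.
  rewrite [X in X @ \oo --> _](_ : _ = (fun n : nat => n%:R^-1 * entropy P (block Y 0 n))).
    by rewrite -Yzero; exact: entropy_rate_cvg.
  apply/funext => n; by rewrite -(entropy_comp_preserving fstP (finite_rv_block 0 mY)).
Qed.
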